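(* Let $k\geq 1$. For every $n\geq 1$, \[ M_k(n)=\sum_{i=1}^{n-1}\sum_{j=1}^{n-i}u_iu_jk^{2n-2(i+j)}+\sum_{i=1}^{\lfloor n/3\rfloor}\big(U_k(i)-u_i\big)\sum_{j=2i}^{n-i}G_i(j)\,G_i(n-j+i),\] with $M_k(1)=0$. Moreover, \[ R_k(n)=\Big(\sum_{i=1}^{n-1}k^{2n-2i}u_i\Big)-M_k(n)\quad\text{and}\quad U_k(n)+2R_k(n)+M_k(n)=k^{2n}.\]
   Context: $\Sigma_k=\{0,1,\ldots,k-1\}$ and $\Sigma_k^n$ is the set of length-$n$ words over $\Sigma_k$. A border of a word $w$ is a non-empty word that is both a proper prefix and a proper suffix of $w$; $w$ is unbordered if it has no border. $u_m$ denotes the number of unbordered words in $\Sigma_k^m$. For a pair of words $(u,v)$: a right-border is a non-empty word that is a proper suffix of $u$ and a proper prefix of $v$; a left-border is a non-empty word that is a proper prefix of $u$ and a proper suffix of $v$. The pair is mutually bordered if it has both a right-border and a left-border, mutually unbordered if it has neither, and right-bordered if it has a right-border but no left-border. $M_k(n)$, $R_k(n)$, $U_k(n)$ denote respectively the numbers of mutually bordered, right-bordered, and mutually unbordered pairs $(u,v)\in\Sigma_k^n\times\Sigma_k^n$. For integers $t\geq 1$ and $m\geq 0$, $G_t(m)$ is defined by $G_t(m)=0$ if $m<2t$ and $G_t(m)=k^{m-2t}-\sum_{i=2t}^{\lfloor m/2\rfloor}G_t(i)k^{m-2i}$ if $m\geq 2t$ (this equals the number of unbordered length-$m$ words with a prescribed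 prefix $x$ and suffix $y$, where $x\neq y$ are length-$t$ words with $(x,y)$ mutually unbordered). *)

(* Defs.v *)
From mathcomp Require Import all_boot all_order all_algebra.

Set Implicit Arguments.
Unset Strict Implicit.
Unset Printing Implicit Defensive.

Import Order.TTheory GRing.Theory Num.Theory.

Section Borders.
Variable T : finType.
Implicit Types x w u v : seq T.

Definition proper_prefix x w : bool := prefix x w && (x != w).
Definition proper_suffix x w : bool := suffix x w && (x != w).

Definition border x w : bool :=
  [&& x != [::], proper_prefix x w & proper_suffix x w].

Definition right_border x u v : bool :=
  [&& x != [::], proper_suffix x u & proper_prefix x v].

Definition left_border x u v : bool :=
  [&& x != [::], proper_prefix x u & proper_suffix x v].

(* Existence of a border is decided by searching among all words shorter than
   the (first) word, which loses nothing since borders are proper; the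
   reflection lemmas below give the unrestricted existential reading. *)
Definition bordered w : bool :=
  [exists l : 'I_(size w), exists x : l.-tuple T, border x w].

Definition has_right_border u v : bool :=
  [exists l : 'I_(size u), exists x : l.-tuple T, right_border x u v].

Definition has_left_border u v : bool :=
  [exists l : 'I_(size u), exists x : l.-tuple T, left_border x u v].

Definition unbordered w : bool := ~~ bordered w.

Definition mutually_bordered u v : bool :=
  has_right_border u v && has_left_border u v.

Definition mutually_unbordered u v : bool :=
  ~~ has_right_border u v && ~~ has_left_border u v.

Definition right_bordered u v : bool :=
  has_right_border u v && ~~ has_left_border u v.

Lemma size_proper_prefix x w : proper_prefix x w -> size x < size w.
Proof.
case/andP=> /prefixP [s ->]; rewrite size_cat.
by case: s => [|a s]; rewrite ?cats0 ?eqxx //= addnS ltnS leq_addr.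
Qed.

Lemma size_proper_suffix x w : proper_suffix x w -> size x < size w.
Proof.
case/andP=> /suffixP [s ->]; rewrite size_cat.
by case: s => [|a s]; rewrite ?eqxx //= ltnS leq_addl.
Qed.

Lemma short_wordP (P : pred (seq T)) n :
    (forall x, P x -> size x < n) ->
  reflect (exists x, P x) [exists l : 'I_n, exists x : l.-tuple T, P x].
Proof.
move=> szP; apply: (iffP existsP) => [[l /existsP[x Px]]|[x Px]].
  by exists x.
by exists (Ordinal (szP x Px)); apply/existsP; exists (in_tuple x).
Qed.

Lemma borderedP w : reflect (exists x, border x w) (bordered w).
Proof. by apply: short_wordP => x /and3P[_ /size_proper_prefix]. Qed.

Lemma has_right_borderP u v :
  reflect (exists x, right_border x u v) (has_right_border u v).
Proof. by apply: short_wordP => x /and3P[_ /size_proper_suffix]. Qed.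

Lemma has_left_borderP u v :
  reflect (exists x, left_border x u v) (has_left_border u v).
Proof. by apply: short_wordP => x /and3P[_ /size_proper_prefix]. Qed.

End Borders.

Section Counting.
Variables k n : nat.
Local Notation word := (n.-tuple 'I_k).

Definition num_unbordered : nat := #|[set w : word | unbordered w]|.

Definition num_mutually_bordered : nat :=
  #|[set p : word * word | mutually_bordered p.1 p.2]|.

Definition num_right_bordered : nat :=
  #|[set p : word * word | right_bordered p.1 p.2]|.

Definition num_mutually_unbordered : nat :=
  #|[set p : word * word | mutually_unbordered p.1 p.2]|.

End Counting.

Local Open Scope ring_scope.

(* G_t(m) is integer-valued: the recurrence does go negative for k = 1. It
   calls itself only at indices i <= m/2, so m.+1 units of fuel suffice; GE
   below is the defining recurrence. *)
Fixpoint G_fuel (k t f m : nat) : int :=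
  if f is f'.+1 then
    if (m < 2 * t)%N then 0
    else k%:Z ^+ (m - 2 * t) -
         \sum_(2 * t <= i < (m %/ 2).+1) G_fuel k t f' i * k%:Z ^+ (m - 2 * i)
  else 0.

Definition G (k t m : nat) : int := G_fuel k t m.+1 m.

Lemma G_fuelE (k t f m : nat) :
  (1 <= t)%N -> (m < f)%N -> G_fuel k t f m = G k t m.
Proof.
move=> t1; rewrite /G.
have H : forall f m f', (m < f)%N -> (m < f')%N ->
    G_fuel k t f m = G_fuel k t f' m.
  elim=> [|g IH] p [|g'] //= ltp ltp'; case: ltnP => // le2p.
  congr (_ - _); apply: eq_big_nat => i /andP[_]; rewrite ltnS => lti; congr (_ * _).
  have ltip : (i < p)%N.
    apply: leq_ltn_trans lti _; apply: ltn_Pdiv => //.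
    by apply: leq_trans le2p; rewrite muln_gt0.
  by apply: IH; apply: (leq_trans ltip).
by move=> ltm; apply: H.
Qed.

Lemma GE (k t m : nat) : (1 <= t)%N ->
  G k t m = if (m < 2 * t)%N then 0
            else k%:Z ^+ (m - 2 * t) -
                 \sum_(2 * t <= i < (m %/ 2).+1) G k t i * k%:Z ^+ (m - 2 * i).
Proof.
move=> t1; rewrite {1}/G [LHS]/=; case: ltnP => // le2m.
congr (_ - _); apply: eq_big_nat => i /andP[_]; rewrite ltnS => lti; congr (_ * _).
apply: G_fuelE => //; apply: leq_ltn_trans lti _; apply: ltn_Pdiv => //.
by apply: leq_trans le2m; rewrite muln_gt0.
Qed.

(* Main.v *)
Require Import Defs.
From mathcomp Require Import all_boot all_order all_algebra.
From mathcomp Require Import zify.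
Import Order.TTheory GRing.Theory Num.Theory.

(* A pair with a right-border has exactly one unbordered right-border, the
   shortest one; likewise on the left.  So mutually bordered pairs (u, v) are
   counted by the lengths i, j of the unbordered right-border x and left-border
   y.  If i + j <= n, then u = y p x and v = x q y with p, q free.  Otherwise x
   and y overlap in t = i + j - n letters in both words: in a inside u and in b
   inside v, so x starts with a and ends with b, y starts with b and ends with
   a.  Unborderedness of x and y forces a <> b, (a, b) mutually unbordered and
   i, j >= 2t, and then x and y can be chosen independently in G_t(i) and
   G_t(j) ways.  The recurrence for G_t is the same argument applied to the
   unique unbordered border of a word, which has at most half its length. *)

Set Implicit Arguments.
Unset Strict Implicit.
Unset Printing Implicit Defensive.

(** * Borders encoded by their lengths *)

Section Overlaps.
Variable T : finType.
Implicit Types (u v w x y z a b : seq T) (l m n t : nat).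

(** A right-border is recorded by its length alone. For words of equal length the bound on [l] makes
    it non-empty and proper in both words. *)
Definition overlap l u v : bool :=
  (0 < l < size u) && (drop (size u - l) u == take l v).

Lemma overlap_lt l u v : overlap l u v -> 0 < l < size u.
Proof. by case/andP. Qed.

Lemma has_right_border_overlapP u v : size u = size v ->
  reflect (exists l, overlap l u v) (has_right_border u v).
Proof.
move=> uv; apply: (iffP (has_right_borderP u v)) => [[x]|[l]].
  case/and3P=> x0 /[dup] /size_proper_suffix xu /andP[/suffixP[p up] _].
  case/andP=> /prefixP[q vq] _.
  exists (size x); rewrite /overlap xu lt0n size_eq0 x0 /=.
  by rewrite up vq size_cat addnK drop_size_cat // take_size_cat.
case/andP=> /andP[l0 lu] /eqP e; exists (take l v).
have sz : size (take l v) = l by rewrite size_takel // -uv ltnW.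
have ne w : size w = size u -> take l v != w.
  by move=> wu; apply/eqP => E; move: lu; rewrite -sz E wu ltnn.
rewrite /right_border /proper_suffix /proper_prefix (ne u) // (ne v) // !andbT.
rewrite -size_eq0 sz -lt0n l0 /= prefixE sz eqxx andbT -e.
by apply/suffixP; exists (take (size u - l) u); rewrite cat_take_drop.
Qed.

Lemma has_left_border_swap u v : size u = size v ->
  has_left_border u v = has_right_border v u.
Proof.
move=> uv; apply/has_left_borderP/has_right_borderP => -[x /and3P[x0 p q]];
  by exists x; apply/and3P.
Qed.

Lemma bordered_self w : bordered w = has_right_border w w.
Proof.
by apply/borderedP/has_right_borderP => -[x /and3P[x0 p q]]; exists x; apply/and3P.
Qed.

Lemma bordered_overlapP w : reflect (exists l, overlap l w w) (bordered w).
Proof. by rewrite bordered_self; apply: has_right_border_overlapP. Qed.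

(** Since [take l v] is also a suffix of [u], its own ends of length [l'] are a suffix of [u] and a
    prefix of [v]. *)
Lemma overlap_take l l' u v : size u = size v -> overlap l u v -> l' < l ->
  overlap l' (take l v) (take l v) = overlap l' u v.
Proof.
move=> uv /andP[/andP[l0 lu] /eqP e] l'l.
have sz : size (take l v) = l by rewrite size_takel // -uv ltnW.
rewrite /overlap sz l'l (ltn_trans l'l lu) take_takel ?(ltnW l'l) //.
rewrite -e drop_drop; congr (_ && (drop _ _ == _)); lia.
Qed.

(** A border of length at most [t] lies within the two ends of [y]. The right side is a bare
    equation so as to cover [l = t], where it reads [a == b]. *)
Lemma overlap_self_ends t l a b y :
    take t y = b -> drop (size y - t) y = a -> t < size y -> 0 < l <= t ->
  overlap l y y = (drop (t - l) a == take l b).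
Proof.
move=> <- <- ty /andP[l0 lt]; rewrite /overlap l0 (leq_ltn_trans lt ty).
rewrite take_takel // drop_drop; congr (drop _ _ == _); lia.
Qed.

(** In a word shorter than [2 * t] the two ends share [2 * t - size x] letters, which close [a] and
    open [b]. *)
Lemma overlap_ends t a b x :
    take t x = a -> drop (size x - t) x = b -> t < size x < 2 * t ->
  overlap (2 * t - size x) a b.
Proof.
move=> <- <- /andP[tx xt]; rewrite /overlap size_takel ?(ltnW tx) //.
apply/andP; split; first lia.
by rewrite take_drop; apply/eqP; congr (drop _ (take _ _)); lia.
Qed.

(* Any shorter overlap is a border of the overlapping word, so the shortest
   overlap is the only unbordered one. *)
Lemma sum_unbordered_overlap u v : size u = size v ->
  (has_right_border u v : nat) =
  \sum_(1 <= l < size u) (overlap l u v && unbordered (take l v)).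
Proof.
move=> uv; case: has_right_border_overlapP => // [ex|nex]; last first.
  by rewrite big1 // => l _; case E: (overlap l u v) => //; case: nex; exists l.
case: (ex_minnP ex) => l0 ol0 l0min.
have key l : (overlap l u v && unbordered (take l v)) = (l == l0).
  apply/andP/eqP => [[ol ub]|->].
    apply/eqP; rewrite eqn_leq l0min // andbT leqNgt; apply/negP => lt.
    by case/negP: ub; apply/bordered_overlapP; exists l0; rewrite (overlap_take uv ol).
  split=> //; apply/bordered_overlapP => -[l' ol'].
  have ll0 : l' < l0.
    case/overlap_lt/andP: ol' => _; rewrite size_takel // -uv ltnW //.
    by case/overlap_lt/andP: ol0.
  by move: ol'; rewrite (overlap_take uv ol0 ll0) => /l0min; rewrite leqNgt ll0.
rewrite (bigD1_seq l0) ?iota_uniq //=; last first.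
  by rewrite mem_index_iota (overlap_lt ol0).
rewrite key eqxx big1 // => l nl; by rewrite key (negbTE nl).
Qed.

(** The two occurrences of a border longer than half of [w] meet, and their common letters form a
    border of that border. *)
Lemma unbordered_border_half l w :
  overlap l w w -> unbordered (take l w) -> 2 * l <= size w.
Proof.
move=> /[dup] ol /andP[/andP[l0 lw] /eqP e] ub; rewrite leqNgt; apply/negP => lt.
case/negP: ub; apply/bordered_overlapP; exists (2 * l - size w).
by apply: overlap_ends (esym _) _; rewrite // lw.
Qed.

(** A bordered word has exactly one unbordered border, and lengths above one half contribute
    nothing. *)
Lemma sum_unbordered_border w :
  (unbordered w) +
  \sum_(1 <= l < (size w %/ 2).+1) (overlap l w w && unbordered (take l w)) = 1.
Proof.
rewrite /unbordered bordered_self -[RHS](addn1 0).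
have -> : \sum_(1 <= l < (size w %/ 2).+1) (overlap l w w && unbordered (take l w))
   = has_right_border w w.
  rewrite sum_unbordered_overlap //.
  (* The empty word is set apart: the cut at [(size w %/ 2).+1] would fall outside its range. *)
  case: (posnP (size w)) => [->|w0]; first by rewrite !big_geq.
  rewrite [RHS](@big_cat_nat _ _ _ (size w %/ 2).+1) /=; [|lia|lia].
  rewrite [X in _ = _ + X]big1_seq ?addn0 // => l /andP[_].
  rewrite mem_index_iota => /andP[lw _].
  case ol: (overlap l w w) => //; case ub: unbordered => //.
  by have := unbordered_border_half ol ub; lia.
by case: has_right_border.
Qed.

End Overlaps.

(** * Sums over words of a fixed length *)

Section WordSums.
Variable T : finType.
Implicit Types (F : seq T -> nat) (n a b c : nat).

(** Summands take sequences rather than tuples, so that words can be cut and concatenated without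
    length casts. *)
Definition wsum n F : nat := \sum_(w : n.-tuple T) F w.

Lemma eq_wsum n F1 F2 :
  (forall s, size s = n -> F1 s = F2 s) -> wsum n F1 = wsum n F2.
Proof. by move=> e; apply: eq_bigr => w _; apply: e; rewrite size_tuple. Qed.

Lemma wsum0 F : wsum 0 F = F [::].
Proof.
rewrite /wsum (bigD1 [tuple]) //= big1 ?addn0 // => w /eqP[]; exact: tuple0.
Qed.

Lemma wsumS n F : wsum n.+1 F = \sum_(x : T) wsum n (fun s => F (x :: s)).
Proof.
rewrite /wsum pair_big /=.
rewrite (reindex (fun p : T * n.-tuple T => cons_tuple p.1 p.2)) //=.
exists (fun w => (thead w, behead_tuple w)) => [[x w]|w] _ /=.
  by congr pair; apply: val_inj.
by rewrite [in RHS](tuple_eta w); apply: val_inj.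
Qed.

Lemma wsum_cat a b n F : n = a + b ->
  wsum n F = wsum a (fun x => wsum b (fun y => F (x ++ y))).
Proof.
move=> ->; elim: a F => [|a IH] F; first by rewrite wsum0.
by rewrite addSn !wsumS; apply: eq_bigr => x _; rewrite IH.
Qed.

Lemma exchange_wsum a b (F : seq T -> seq T -> nat) :
  wsum a (fun x => wsum b (F x)) = wsum b (fun y => wsum a (F^~ y)).
Proof. exact: exchange_big. Qed.

Lemma wsum_mull n c F : wsum n (fun x => c * F x) = c * wsum n F.
Proof. by rewrite /wsum big_distrr. Qed.

Lemma wsum_mulr n c F : wsum n (fun x => F x * c) = wsum n F * c.
Proof. by rewrite /wsum big_distrl. Qed.

Lemma wsum_const n c : wsum n (fun=> c) = #|T| ^ n * c.
Proof. by rewrite /wsum sum_nat_const card_tuple. Qed.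

Lemma wsum_sum n p q (F : nat -> seq T -> nat) :
  wsum n (fun x => \sum_(p <= i < q) F i x) = \sum_(p <= i < q) wsum n (F i).
Proof. exact: exchange_big. Qed.

Lemma wsumD n F1 F2 : wsum n (fun x => F1 x + F2 x) = wsum n F1 + wsum n F2.
Proof. exact: big_split. Qed.

(** Mostly used from right to left: it turns a value at [z] into a sum over a new word forced to
    equal [z], so that two sums can be matched term by term. *)
Lemma wsum_delta n z F : size z = n ->
  wsum n (fun x => (z == x) * F x) = F z.
Proof.
move=> zn; have zn' : size z == n by rewrite zn.
rewrite /wsum (bigD1 (Tuple zn')) //= eqxx mul1n big1 ?addn0 // => x nx.
case: eqP => // e; case/eqP: nx; exact: val_inj.
Qed.

Lemma wsum_neq0 n F : wsum n F != 0 -> exists2 x, size x = n & F x != 0.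
Proof.
rewrite /wsum sum_nat_eq0 negb_forall => /existsP[x /= Fx].
by exists x; rewrite ?size_tuple.
Qed.

Lemma card_words n (P : pred (seq T)) :
  #|[set w : n.-tuple T | P w]| = wsum n (fun w => P w).
Proof.
by rewrite /wsum -sum1_card big_mkcond; apply: eq_bigr => w _; rewrite inE; case: (P w).
Qed.

Lemma card_word_pairs n (P : seq T -> seq T -> bool) :
  #|[set p : n.-tuple T * n.-tuple T | P p.1 p.2]| =
  wsum n (fun u => wsum n (fun v => P u v)).
Proof.
rewrite /wsum pair_big /= -sum1_card big_mkcond.
by apply: eq_bigr => w _; rewrite inE; case: (P _ _).
Qed.

End WordSums.

(** * Counting pairs by the lengths of their unbordered borders *)

Section Counts.
Variable T : finType.
Implicit Types (u v w x y z a b : seq T) (l m n t : nat).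

Local Notation wsum := (@wsum T).
Local Notation K := #|T|.
Local Notation nunb n := (wsum n (fun w => unbordered w)).

Lemma nonempty_size_gt0 x : (x != [::]) = (0 < size x).
Proof. by case: x. Qed.

Lemma overlap_cat (p x y q : seq T) : x != [::] -> p != [::] -> size x = size y ->
  overlap (size x) (p ++ x) (y ++ q) = (x == y).
Proof.
rewrite !nonempty_size_gt0 => x0 p0 xy; rewrite /overlap size_cat addnK.
rewrite drop_size_cat // xy take_size_cat // -xy.
by have -> : 0 < size x < size p + size x by lia.
Qed.

Lemma nonempty_size x n : size x = n -> 0 < n -> x != [::].
Proof. by move=> <-; rewrite nonempty_size_gt0. Qed.

(** Here [u = p ++ x] and [v = x ++ q] with [x] unbordered, while [p] and [q] are free words of
    length [n - l]. *)
Lemma sum_overlap_fixed n l : 0 < l < n ->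
  wsum n (fun u => wsum n (fun v => overlap l u v && unbordered (take l v))) =
  K ^ (2 * n - 2 * l) * nunb l.
Proof.
move=> ln; rewrite (@wsum_cat _ (n - l) l); last lia.
transitivity (wsum (n - l) (fun=> wsum l (fun x => K ^ (n - l) * unbordered x))).
  apply: eq_wsum => p pn; apply: eq_wsum => x xl.
  rewrite (@wsum_cat _ l (n - l)); last lia.
  rewrite -(wsum_delta (fun y => K ^ (n - l) * unbordered y) xl).
  apply: eq_wsum => y yl; rewrite mulnCA -wsum_const; apply: eq_wsum => q _.
  have x0 : x != [::] by apply: (nonempty_size xl); lia.
  have p0 : p != [::] by apply: (nonempty_size pn); lia.
  rewrite -xl overlap_cat ?xl ?yl //.
  by rewrite take_size_cat ?yl // mulnb.
by rewrite wsum_const wsum_mull mulnA -expnD; congr (_ ^ _ * _); lia.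
Qed.

Lemma sum_has_right_border n :
  wsum n (fun u => wsum n (fun v => has_right_border u v)) =
  \sum_(1 <= l < n) K ^ (2 * n - 2 * l) * nunb l.
Proof.
transitivity (wsum n (fun u => wsum n (fun v =>
    \sum_(1 <= l < n) (overlap l u v && unbordered (take l v))))).
  apply: eq_wsum => u un; apply: eq_wsum => v vn.
  by rewrite sum_unbordered_overlap ?un ?vn.
transitivity (wsum n (fun u => \sum_(1 <= l < n) wsum n (fun v =>
    overlap l u v && unbordered (take l v)))).
  by apply: eq_wsum => u _; rewrite wsum_sum.
by rewrite wsum_sum; apply: eq_big_nat => l ln; rewrite sum_overlap_fixed.
Qed.

(** The left-border of [(u, v)] is treated as a right-border of [(v, u)], hence the swapped
    arguments. *)
Definition two_overlaps i j u v : bool :=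
  (overlap i u v && unbordered (take i v)) && (overlap j v u && unbordered (take j u)).

(** The indicator is the product of the right and left ones, and each expands over the length of its
    unique unbordered border. *)
Lemma sum_mutually_bordered n :
  wsum n (fun u => wsum n (fun v => mutually_bordered u v)) =
  \sum_(1 <= i < n) \sum_(1 <= j < n)
    wsum n (fun u => wsum n (fun v => two_overlaps i j u v)).
Proof.
transitivity (wsum n (fun u => wsum n (fun v =>
    \sum_(1 <= i < n) \sum_(1 <= j < n) two_overlaps i j u v))).
  apply: eq_wsum => u un; apply: eq_wsum => v vn.
  rewrite /mutually_bordered has_left_border_swap ?un ?vn // -mulnb.
  rewrite !sum_unbordered_overlap ?un ?vn // big_distrl /=.
  apply: eq_bigr => i _; rewrite big_distrr /=.
  by apply: eq_bigr => j _; rewrite mulnb.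
transitivity (wsum n (fun u => \sum_(1 <= i < n) \sum_(1 <= j < n)
    wsum n (fun v => two_overlaps i j u v))).
  apply: eq_wsum => u _; rewrite wsum_sum; apply: eq_bigr => i _.
  by rewrite wsum_sum.
by rewrite wsum_sum; apply: eq_bigr => i _; rewrite wsum_sum.
Qed.

Lemma sum_two_overlaps_short n i j : 0 < i -> 0 < j -> i + j <= n ->
  wsum n (fun u => wsum n (fun v => two_overlaps i j u v)) =
  nunb i * nunb j * K ^ (2 * n - 2 * (i + j)).
Proof.
move=> i0 j0 ijn; pose m := n - (i + j).
rewrite (@wsum_cat _ j (m + i)); last by rewrite /m; lia.
transitivity (wsum j (fun y => wsum m (fun=> wsum i (fun x =>
    unbordered y * (K ^ m * unbordered x))))).
  apply: eq_wsum => y yj; rewrite (@wsum_cat _ m i) //.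
  apply: eq_wsum => p pm; apply: eq_wsum => x xi.
  rewrite (@wsum_cat _ i (m + j)); last by rewrite /m; lia.
  rewrite mulnCA.
  (* The words [x'] and, below, [y'] are the outer blocks of [v]; the overlaps force them to equal
     the blocks [x] and [y] of [u]. *)
  rewrite -(wsum_delta (fun x' => K ^ m * (unbordered y * unbordered x')) xi).
  apply: eq_wsum => x' x'i; rewrite (@wsum_cat _ m j) // mulnCA -wsum_const.
  apply: eq_wsum => q qm.
  rewrite -(wsum_delta (fun y' => (x == x') * (unbordered y' * unbordered x')) yj).
  apply: eq_wsum => y' y'j; rewrite /two_overlaps.
  have x0 := nonempty_size xi i0; have y0 := nonempty_size y'j j0.
  have yp : y ++ p != [::] by rewrite nonempty_size_gt0 size_cat yj; lia.
  have xq : x' ++ q != [::] by rewrite nonempty_size_gt0 size_cat x'i; lia.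
  have -> : overlap i (y ++ p ++ x) (x' ++ q ++ y') = (x == x').
    by rewrite catA -xi overlap_cat // xi.
  have -> : overlap j (x' ++ q ++ y') (y ++ p ++ x) = (y' == y).
    by rewrite catA -y'j overlap_cat // yj.
  rewrite !take_size_cat //.
  rewrite (eq_sym y'); case: (eqVneq y y') => [<-|]; rewrite ?andbF //=.
  by case: (x == x'); case: (unbordered x'); case: (unbordered y).
transitivity (wsum j (fun y => unbordered y * (K ^ m * (K ^ m * nunb i)))).
  by apply: eq_wsum => y _; rewrite wsum_const !wsum_mull mulnCA.
rewrite wsum_mulr (mulnA (K ^ m)) -expnD (mulnC (nunb i)) -mulnA (mulnC (nunb i)).
by congr (_ * (_ ^ _ * _)); rewrite /m; lia.
Qed.

(** * Unbordered words with prescribed ends *)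

(** This is the quantity that [G] evaluates for suitable ends. It also makes sense when the two ends
    overlap inside the word. *)
Definition ends_count m a b : nat :=
  wsum m (fun x => [&& take (size a) x == a, drop (m - size b) x == b & unbordered x]).

(** The word is read twice, as [a ++ d] and as [e ++ b], because a border shared by [u] and [v] is
    cut differently in each of them. *)
Lemma ends_countE m a b : size a = size b -> size a <= m ->
  ends_count m a b =
  wsum (m - size a) (fun d => wsum (m - size a) (fun e =>
    (a ++ d == e ++ b) && unbordered (e ++ b))).
Proof.
move=> ab am; rewrite /ends_count (@wsum_cat _ (size a) (m - size a)); last lia.
transitivity (wsum (size a) (fun a' => (a == a') *
   wsum (m - size a) (fun d =>
   (drop (m - size b) (a' ++ d) == b) && unbordered (a' ++ d)))).
  apply: eq_wsum => a' a'a; rewrite -wsum_mull; apply: eq_wsum => d _.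
  by rewrite take_size_cat // eq_sym mulnb.
rewrite wsum_delta //; apply: eq_wsum => d dm.
set s := a ++ d; have ss : size s = m by rewrite size_cat dm; lia.
rewrite -(@wsum_delta _ (m - size a) (take (m - size a) s)
   (fun=> (drop (m - size b) s == b) && unbordered s)); last by rewrite size_takel // ss leq_subr.
apply: eq_wsum => e em.
rewrite -[in RHS](cat_take_drop (m - size a) s) eqseq_cat; last first.
  by rewrite em size_takel // ss leq_subr.
rewrite mulnb ab andbA; case: eqP => //= <-; case: eqP => //= db.
by rewrite -[in LHS](cat_take_drop (m - size b) s) db.
Qed.

(** Cut [u = c ++ a ++ d] and [v = e ++ b ++ f] with [a], [b] of length [i + j - n]. The
    right-border is [a ++ d = e ++ b] and the left-border is [c ++ a = b ++ f]. For fixed [a] and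
    [b] the first involves only [d], [e] and the second only [c], [f], so the count factors. *)
Lemma sum_two_overlaps_long n i j : i < n -> j < n -> n < i + j ->
  wsum n (fun u => wsum n (fun v => two_overlaps i j u v)) =
  wsum (i + j - n) (fun a => wsum (i + j - n) (fun b =>
    ends_count i a b * ends_count j b a)).
Proof.
move=> iN jN nij; set t := i + j - n.
pose X a d e b : nat := (a ++ d == e ++ b) && unbordered (e ++ b).
transitivity (wsum (n - i) (fun c => wsum t (fun a => wsum (n - j) (fun d =>
   wsum (n - j) (fun e => wsum t (fun b => wsum (n - i) (fun f =>
     X a d e b * X b f c a))))))).
  rewrite (@wsum_cat _ (n - i) i); last lia.
  apply: eq_wsum => c cs; rewrite (@wsum_cat _ t (n - j)); last by rewrite /t; lia.
  apply: eq_wsum => a as_; apply: eq_wsum => d ds.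
  rewrite (@wsum_cat _ (n - j) j); last lia.
  apply: eq_wsum => e es; rewrite (@wsum_cat _ t (n - i)); last by rewrite /t; lia.
  apply: eq_wsum => b bs; apply: eq_wsum => f fs.
  have adi : size (a ++ d) = i by rewrite size_cat as_ ds /t; lia.
  have ebi : size (e ++ b) = i by rewrite size_cat es bs /t; lia.
  have bfj : size (b ++ f) = j by rewrite size_cat fs bs /t; lia.
  have caj : size (c ++ a) = j by rewrite size_cat cs as_ /t; lia.
  have ad0 : a ++ d != [::] by apply: (nonempty_size adi); lia.
  have bf0 : b ++ f != [::] by apply: (nonempty_size bfj); lia.
  have c0 : c != [::] by apply: (nonempty_size cs); lia.
  have e0 : e != [::] by apply: (nonempty_size es); lia.
  have -> : two_overlaps i j (c ++ a ++ d) (e ++ b ++ f) =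
      ((a ++ d == e ++ b) && unbordered (e ++ b)) &&
      ((b ++ f == c ++ a) && unbordered (c ++ a)).
    rewrite /two_overlaps; congr (_ && _ && (_ && _)).
    - by rewrite (catA e) -adi overlap_cat // adi.
    - by rewrite catA take_size_cat.
    - by rewrite (catA c) -bfj overlap_cat // bfj.
    - by rewrite catA take_size_cat.
  by rewrite /X mulnb.
rewrite exchange_wsum; apply: eq_wsum => a as_.
transitivity (wsum (n - i) (fun c => wsum t (fun b => wsum (n - j) (fun d =>
   wsum (n - j) (fun e => wsum (n - i) (fun f => X a d e b * X b f c a)))))).
  apply: eq_wsum => c _; rewrite [RHS]exchange_wsum; apply: eq_wsum => d _.
  exact: exchange_wsum.
rewrite exchange_wsum; apply: eq_wsum => b bs.
rewrite !ends_countE ?as_ ?bs //; try (rewrite /t; lia).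
have -> : i - t = n - j by rewrite /t; lia.
have -> : j - t = n - i by rewrite /t; lia.
(* The second factor expands with [f] outside [c]; the exchange restores the order of the left
   side. *)
rewrite [X in _ = _ * X]exchange_wsum -wsum_mull; apply: eq_wsum => c _.
rewrite -wsum_mulr; apply: eq_wsum => d _; rewrite -wsum_mulr; apply: eq_wsum => e _.
by rewrite wsum_mull.
Qed.

(** * Mutually unbordered ends and the recurrence for [G] *)

Lemma mutually_unbordered_overlap a b l : size a = size b ->
  mutually_unbordered a b -> (overlap l a b = false) * (overlap l b a = false).
Proof.
move=> ab /andP[]; rewrite has_left_border_swap // => rb lb.
split; apply/negbTE; [apply: contra rb|apply: contra lb] => ol;
  by apply/has_right_border_overlapP; [|exists l].
Qed.

Lemma mutually_unbordered_sym a b : size a = size b ->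
  mutually_unbordered a b = mutually_unbordered b a.
Proof. by move=> ab; rewrite /mutually_unbordered !has_left_border_swap // andbC. Qed.

(** A border with [l < t] would be an overlap from [b] to [a]; [l = t] would give [a = b]; and for
    [t < l < 2 * t] the ends [a] and [b] of the border itself would overlap. *)
Lemma border_length_ge a b w t l :
    a != b -> mutually_unbordered a b -> size a = t -> size b = t ->
    take t w = a -> drop (size w - t) w = b -> t < size w -> overlap l w w ->
  2 * t <= l.
Proof.
move=> nab mu at_ bt wa wb tw ol; rewrite leqNgt; apply/negP => lt.
have [l0 lw] := andP (overlap_lt ol).
have noab l' := mutually_unbordered_overlap l' (etrans at_ (esym bt)) mu.
case: (leqP l t) => [lt'|tl].
  have := overlap_self_ends wa wb tw (_ : 0 < l <= t); rewrite l0 lt' ol => /(_ isT) e.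
  case: (ltngtP l t) lt' => // [ltt _|elt _].
    by have := (noab l).2; rewrite /overlap bt l0 ltt -e.
  by move: nab e; rewrite elt subnn drop0 -at_ take_oversize ?at_ // eq_sym => /negbTE->.
have sz : size (take l w) = l by rewrite size_takel // ltnW.
have: overlap (2 * t - size (take l w)) a b.
  apply: overlap_ends; rewrite ?sz ?tl //; first by rewrite take_takel // ltnW.
  case/andP: ol => _ /eqP<-; rewrite drop_drop -wb; congr drop; lia.
by rewrite (noab _).1.
Qed.

Lemma sum_prescribed_ends a b m t : size a = t -> size b = t -> 2 * t <= m ->
  wsum m (fun w => (take t w == a) && (drop (m - t) w == b)) = K ^ (m - 2 * t).
Proof.
move=> at_ bt tm; rewrite (@wsum_cat _ t (m - 2 * t + t)); last lia.
rewrite -(wsum_delta (fun=> K ^ (m - 2 * t)) at_).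
apply: eq_wsum => a' a's; rewrite (@wsum_cat _ (m - 2 * t) t) //.
rewrite (mulnC (a == a')) -wsum_const; apply: eq_wsum => p ps.
rewrite -(wsum_delta (fun=> nat_of_bool (a == a')) bt); apply: eq_wsum => b' bs.
rewrite take_size_cat // catA drop_size_cat; last by rewrite size_cat a's ps; lia.
by rewrite mulnb eq_sym andbC [in RHS](eq_sym b).
Qed.

(** Such a word is [z ++ p ++ z] with [z] unbordered of length [l] and [p] free. As [l] exceeds [t],
    the prescribed ends are those of [z]. *)
Lemma sum_prescribed_ends_border a b m t l :
    0 < t -> size a = t -> size b = t -> 2 * t <= l -> 2 * l <= m ->
  wsum m (fun w => ((take t w == a) && (drop (m - t) w == b)) *
                   (overlap l w w && unbordered (take l w))) =
  K ^ (m - 2 * l) * ends_count l a b.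
Proof.
move=> t0 at_ bt tl lm; rewrite (@wsum_cat _ l (m - 2 * l + l)); last lia.
rewrite -wsum_mull; apply: eq_wsum => z zl.
rewrite (@wsum_cat _ (m - 2 * l) l) // -wsum_const; apply: eq_wsum => p ps.
rewrite at_ bt -(wsum_delta
  (fun z' => nat_of_bool [&& take t z == a, drop (l - t) z' == b & unbordered z]) zl).
apply: eq_wsum => z' z's.
have z'0 : z' != [::] by apply: (nonempty_size z's); lia.
have zp0 : z ++ p != [::] by rewrite nonempty_size_gt0 size_cat zl; lia.
have -> : overlap l (z ++ p ++ z') (z ++ p ++ z') = (z' == z).
  by rewrite {1}catA -z's overlap_cat // z's.
rewrite [take l _]take_size_cat // [take t _]takel_cat ?zl; last lia.
rewrite catA drop_cat size_cat zl ps ifN; last lia.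
have -> : m - t - (l + (m - 2 * l)) = l - t by lia.
rewrite (eq_sym z') !mulnb; case: (z == z'); rewrite ?andbF //=.
by rewrite andbA.
Qed.

(** All words with these ends are sorted by their unbordered border, if any. The subtraction in the
    recurrence of [G] appears as an addition, to stay within natural numbers. *)
Lemma ends_count_rec a b m t :
    0 < t -> size a = t -> size b = t -> a != b -> mutually_unbordered a b ->
    2 * t <= m ->
  K ^ (m - 2 * t) = ends_count m a b +
    \sum_(2 * t <= l < (m %/ 2).+1) K ^ (m - 2 * l) * ends_count l a b.
Proof.
move=> t0 at_ bt nab mu tm; rewrite -(sum_prescribed_ends at_ bt tm).
pose A w := (take t w == a) && (drop (m - t) w == b).
transitivity (wsum m (fun w => A w * unbordered w +
   \sum_(1 <= l < (m %/ 2).+1) A w * (overlap l w w && unbordered (take l w)))).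
  apply: eq_wsum => w wm.
  by have := sum_unbordered_border w; rewrite -big_distrr -mulnDr wm => ->; rewrite muln1.
rewrite wsumD; congr (_ + _).
  by apply: eq_wsum => w _; rewrite at_ bt mulnb andbA.
rewrite wsum_sum.
have small l : l < 2 * t ->
    wsum m (fun w => A w * (overlap l w w && unbordered (take l w))) = 0.
  move=> lt; apply/eqP; apply/negP => /negP /wsum_neq0[w wm].
  rewrite /A mulnb eqb0 negbK => /andP[/andP[/eqP wa /eqP wb] /andP[ol _]].
  rewrite -wm in wb; have := border_length_ge nab mu at_ bt wa wb _ ol; lia.
(* If [m] is too small the range from [2 * t] is empty, and every border length up to [m %/ 2] is
   already excluded by [small]. *)
case: (leqP (2 * t) (m %/ 2).+1) => [tm2|tm2]; last first.
  rewrite [RHS]big_geq ?(ltnW tm2) // big1_seq // => l /andP[_].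
  by rewrite mem_index_iota => lr; apply: small; lia.
rewrite (@big_cat_nat _ _ _ (2 * t)) //=; last lia.
rewrite big1_seq ?add0n; last first.
  by move=> l /andP[_]; rewrite mem_index_iota => lr; apply: small; lia.
apply: eq_big_nat => l lr; apply: sum_prescribed_ends_border => //; lia.
Qed.

Lemma ends_count_G a b m t :
    0 < t -> size a = t -> size b = t -> a != b -> mutually_unbordered a b ->
    2 * t <= m ->
  Posz (ends_count m a b) = G K t m.
Proof.
move=> t0 at_ bt nab mu; elim/ltn_ind: m => m IH tm.
rewrite GE // ltnNge tm /= -[LHS](addrK (Posz
  (\sum_(2 * t <= l < (m %/ 2).+1) K ^ (m - 2 * l) * ends_count l a b)))%R.
rewrite -PoszD -(ends_count_rec t0 at_ bt nab mu tm).
congr (_ - _)%R; first by rewrite -[LHS]natz natrX natz.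
rewrite -[LHS]natz natr_sum; apply: eq_big_nat => l lr.
rewrite -IH; [|lia|lia].
by rewrite natrM natrX !natz mulrC.
Qed.

(** Take unbordered witnesses [x] and [y]. An overlap from [b] to [a] would be a border of [x], one
    from [a] to [b] a border of [y], and [a = b] again a border of [x]. Ends meeting inside [x] or
    [y] would create such an overlap, whence the length bounds. *)
Lemma ends_count_neq0 a b i j t :
    0 < t -> size a = t -> size b = t -> t < i -> t < j ->
    ends_count i a b * ends_count j b a != 0 ->
  [&& a != b, mutually_unbordered a b, 2 * t <= i & 2 * t <= j].
Proof.
move=> t0 at_ bt ti tj; rewrite muln_eq0 negb_or => /andP[].
case/wsum_neq0=> x xi; rewrite at_ bt eqb0 negbK => /and3P[/eqP xa /eqP xb xu].
case/wsum_neq0=> y yj; rewrite at_ bt eqb0 negbK => /and3P[/eqP yb /eqP ya yu].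
have ab : size a = size b by rewrite at_ bt.
have nox l : overlap l x x = false.
  by apply/negP => ol; case/negP: xu; apply/bordered_overlapP; exists l.
have noy l : overlap l y y = false.
  by apply/negP => ol; case/negP: yu; apply/bordered_overlapP; exists l.
rewrite -xi in xb ti; rewrite -yj in ya tj.
have noba l : overlap l b a = false.
  apply/negP => /andP[/andP[l0 lt]]; rewrite bt -(overlap_self_ends xa xb ti) ?nox //.
  by rewrite l0 -bt ltnW.
have noab l : overlap l a b = false.
  apply/negP => /andP[/andP[l0 lt]]; rewrite at_ -(overlap_self_ends yb ya tj) ?noy //.
  by rewrite l0 -at_ ltnW.
apply/and4P; split.
- apply/eqP => E; have := overlap_self_ends xa xb ti (_ : 0 < t <= t).
  rewrite t0 leqnn nox subnn drop0 -E => /(_ isT).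
  by rewrite take_oversize ?at_ // eqxx.
- rewrite /mutually_unbordered has_left_border_swap //; apply/andP; split.
    by apply/has_right_border_overlapP => // -[l]; rewrite noab.
  by apply/has_right_border_overlapP => // -[l]; rewrite noba.
- rewrite -xi leqNgt; apply/negP => lt.
  by have := overlap_ends xa xb; rewrite ti lt noab => /(_ isT).
- rewrite -yj leqNgt; apply/negP => lt.
  by have := overlap_ends yb ya; rewrite tj lt noba => /(_ isT).
Qed.

(** On the diagonal, [(a, a)] is mutually unbordered exactly when [a] is unbordered. This is the
    source of the factor $U_k(t)-u_t$. *)
Lemma sum_distinct_mutually_unbordered t :
  wsum t (fun a => wsum t (fun b => (a != b) && mutually_unbordered a b)) + nunb t =
  wsum t (fun a => wsum t (fun b => mutually_unbordered a b)).
Proof.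
rewrite -wsumD; apply: eq_wsum => a at_.
have -> : nat_of_bool (unbordered a) = mutually_unbordered a a.
  by rewrite /mutually_unbordered has_left_border_swap // andbb -bordered_self.
rewrite -(wsum_delta (fun b => nat_of_bool (mutually_unbordered a b)) at_) -wsumD.
by apply: eq_wsum => b _; case: (a == b); case: mutually_unbordered.
Qed.

(** Only distinct mutually unbordered [(a, b)] contribute, and each contributes the same product of
    values of [G]. *)
Lemma sum_two_overlaps_long_G n i j : i < n -> j < n -> n < i + j ->
  (Posz (wsum n (fun u => wsum n (fun v => two_overlaps i j u v))) =
  (Posz (wsum (i + j - n) (fun a => wsum (i + j - n) (fun b => mutually_unbordered a b)))
   - Posz (nunb (i + j - n))) * (G K (i + j - n) j * G K (i + j - n) i))%R.
Proof.
move=> iN jN nij; rewrite sum_two_overlaps_long //; set t := i + j - n.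
have [t0 ti' tj'] : [/\ 0 < t, t < i & t < j] by rewrite /t; split; lia.
rewrite -sum_distinct_mutually_unbordered PoszD addrK.
rewrite -![Posz (wsum _ _)]natz !natr_sum mulr_suml; apply: eq_bigr => a _.
rewrite !natr_sum mulr_suml; apply: eq_bigr => b _.
have [at_ bt] := (size_tuple a, size_tuple b).
have prod_neq0 (ne : Posz (ends_count i a b * ends_count j b a) != 0%R) :=
  @ends_count_neq0 a b i j t t0 at_ bt ti' tj' ne.
rewrite !natz; case: (boolP ((tval a != b) && mutually_unbordered a b)) => [/andP[nab mu]|bad].
  (* When [i] or [j] is below [2 * t], [G] vanishes by its first branch and the word count vanishes
     by [ends_count_neq0]. *)
  rewrite mul1r; case: (leqP (2 * t) i) => ti; last first.
    rewrite [G K t i]GE // ti mulr0; apply/eqP; apply: contraLR ti => ne.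
    by rewrite -leqNgt; case/and4P: (prod_neq0 ne).
  case: (leqP (2 * t) j) => tj; last first.
    rewrite [G K t j]GE // tj mul0r; apply/eqP; apply: contraLR tj => ne.
    by rewrite -leqNgt; case/and4P: (prod_neq0 ne).
  rewrite PoszM (ends_count_G t0 at_ bt nab mu ti) mulrC.
  by rewrite (ends_count_G t0 bt at_ _ _ tj) // 1?eq_sym // mutually_unbordered_sym // bt at_.
rewrite mul0r; apply/eqP; apply: contraR bad => ne.
by case/and4P: (prod_neq0 ne) => -> ->.
Qed.
End Counts.

(** * Reindexing by the length of the overlap of the two borders *)

(** With [t = i + j - n], a nonzero term has [i, j >= 2 * t], so [n + t >= 4 * t] and [t <= n %/ 3].
    As [i = n - j + t], the bound on [i] becomes [j <= n - t]. *)
Lemma sum_reindex_overlap (F : nat -> nat -> nat -> int) n :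
    (forall t i j, (i < 2 * t) || (j < 2 * t) -> F t i j = 0%R) ->
  (\sum_(1 <= i < n) \sum_((n - i).+1 <= j < n) F (i + j - n)%N i j =
   \sum_(1 <= t < (n %/ 3).+1) \sum_(2 * t <= j < (n - t).+1) F t (n - j + t)%N j)%R.
Proof.
move=> F0.
transitivity (\sum_(1 <= j < n) \sum_(1 <= t < j) F t (n - j + t)%N j)%R.
  transitivity (\sum_(1 <= i < n) \sum_(1 <= j < n | (n - i < j)%N) F (i + j - n)%N i j)%R.
    by apply: eq_big_nat => i lr; rewrite (big_nat_widenl (n - i).+1 1).
  rewrite (exchange_big_dep_nat predT) //=; apply: eq_big_nat => j jr.
  transitivity (\sum_((n - j).+1 <= i < n) F (i + j - n)%N i j)%R.
    rewrite [RHS](big_nat_widenl (n - j).+1 1) // [LHS]big_nat_cond [RHS]big_nat_cond.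
    by apply: eq_bigl => i; lia.
  (* Substitutes [i = t + (n - j)], which turns the range of [i] into [1 <= t < j]. *)
  rewrite -add1n big_addn; have -> : n - (n - j) = j by lia.
  by apply: eq_big_nat => t tr; congr F; lia.
transitivity (\sum_(1 <= t < n) \sum_(1 <= j < n | (t < j)%N) F t (n - j + t)%N j)%R.
  transitivity (\sum_(1 <= j < n) \sum_(1 <= t < n | (t < j)%N) F t (n - j + t)%N j)%R.
    by apply: eq_big_nat => j jr; rewrite (big_nat_widen 1 j n) //; lia.
  by rewrite (exchange_big_dep_nat predT).
case: (posnP n) => [->|n0]; first by rewrite !big_geq.
rewrite (@big_cat_nat _ _ _ (n %/ 3).+1) //=; last lia.
rewrite [X in (_ + X)%R]big1_seq ?addr0; last first.
  move=> t /andP[_]; rewrite mem_index_iota => tr.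
  rewrite big1_seq // => j /andP[tj]; rewrite mem_index_iota => jr.
  by apply: F0; lia.
apply: eq_big_nat => t tr.
rewrite (big_nat_widenl (2 * t) 1); last lia.
rewrite (big_nat_widen 1 (n - t).+1 n); last lia.
rewrite [LHS]big_mkcond [RHS]big_mkcond; apply: eq_big_nat => j jr /=.
(* The target range implies [t < j] because [t] is positive; outside it one of the two lengths is
   below [2 * t]. *)
case: ifP => tj; case: ifP => // c; last by lia.
by apply: F0; lia.
Qed.

(** * Assembling the counting identities *)

Local Open Scope ring_scope.

Theorem theorem9 (k n : nat) (hk : (1 <= k)%N) (hn : (1 <= n)%N) :
  [/\ (num_mutually_bordered k n)%:Z =
        \sum_(1 <= i < n) \sum_(1 <= j < (n - i).+1)
           (num_unbordered k i)%:Z * (num_unbordered k j)%:Z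
             * k%:Z ^+ (2 * n - 2 * (i + j))
        + \sum_(1 <= i < (n %/ 3).+1)
            ((num_mutually_unbordered k i)%:Z - (num_unbordered k i)%:Z)
              * \sum_(2 * i <= j < (n - i).+1) G k i j * G k i (n - j + i),
      num_mutually_bordered k 1 = 0%N,
      (num_right_bordered k n)%:Z =
        \sum_(1 <= i < n) k%:Z ^+ (2 * n - 2 * i) * (num_unbordered k i)%:Z
        - (num_mutually_bordered k n)%:Z
    & (num_mutually_unbordered k n + 2 * num_right_bordered k n
        + num_mutually_bordered k n = k ^ (2 * n))%N ].
Proof.
have uE m : num_unbordered k m = wsum m (fun w : seq 'I_k => unbordered w).
  exact: (card_words m (@unbordered 'I_k)).
have UE m : num_mutually_unbordered k m =
    wsum m (fun u : seq 'I_k => wsum m (fun v => mutually_unbordered u v)).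
  exact: (card_word_pairs m (@mutually_unbordered 'I_k)).
have ME m : num_mutually_bordered k m =
    wsum m (fun u : seq 'I_k => wsum m (fun v => mutually_bordered u v)).
  exact: (card_word_pairs m (@mutually_bordered 'I_k)).
have RE m : num_right_bordered k m =
    wsum m (fun u : seq 'I_k => wsum m (fun v => right_bordered u v)).
  exact: (card_word_pairs m (@right_bordered 'I_k)).
have cE : (#|'I_k| = k)%N := card_ord k.
(* Together these two classes are all the pairs with a right-border. *)
have RM : (num_right_bordered k n + num_mutually_bordered k n =
    \sum_(1 <= l < n) k ^ (2 * n - 2 * l) * num_unbordered k l)%N.
  transitivity (wsum n (fun u : seq 'I_k => wsum n (fun v => has_right_border u v))).
    rewrite RE ME -wsumD; apply: eq_wsum => u _; rewrite -wsumD; apply: eq_wsum => v _.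
    rewrite /right_bordered /mutually_bordered.
    by case: has_right_border; case: has_left_border.
  by rewrite sum_has_right_border cE; apply: eq_bigr => l _; rewrite uE.
split.
- rewrite ME sum_mutually_bordered -[LHS]natz natr_sum.
  (* The value at [t = 0] is a default: [i + j - n] is positive on the range where the borders
     overlap. *)
  pose F t i j := ((num_mutually_unbordered k t)%:Z - (num_unbordered k t)%:Z) *
     (if t is 0 then 0 else G k t j * G k t i).
  transitivity (\sum_(1 <= i < n) (\sum_(1 <= j < (n - i).+1)
           (num_unbordered k i)%:Z * (num_unbordered k j)%:Z
             * k%:Z ^+ (2 * n - 2 * (i + j)) +
      \sum_((n - i).+1 <= j < n) F (i + j - n)%N i j)).
    apply: eq_big_nat => i ir; rewrite natr_sum.
    rewrite (@big_cat_nat _ _ _ (n - i).+1) //=; last lia.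
    congr (_ + _); apply: eq_big_nat => j jr; rewrite natz.
      rewrite sum_two_overlaps_short; [|lia|lia|lia].
      by rewrite -[LHS]natz !natrM natrX !natz cE -!uE.
    rewrite sum_two_overlaps_long_G; [|lia|lia|lia].
    by rewrite cE -uE -UE /F; case E: (i + j - n)%N => //; lia.
  rewrite big_split; congr (_ + _); rewrite sum_reindex_overlap.
    apply: eq_big_nat => t tr; rewrite mulr_sumr; apply: eq_bigr => j _.
    by rewrite /F; case: t tr.
  move=> [|t] i j ij; rewrite /F ?mulr0 //.
  case/orP: ij => lt; first by rewrite [G k _ i]GE // lt !mulr0.
  by rewrite [G k _ j]GE // lt mul0r mulr0.
- by rewrite ME sum_mutually_bordered big_geq.
- rewrite -[LHS](addrK (num_mutually_bordered k n)%:Z) -PoszD RM; congr (_ - _).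
  rewrite -[LHS]natz natr_sum; apply: eq_bigr => l _.
  by rewrite natrM natrX !natz.
(* Swapping [u] and [v] matches right-bordered pairs with those having only a left-border, which
   explains the coefficient 2. *)
- have RS : num_right_bordered k n = wsum n (fun u : seq 'I_k => wsum n (fun v =>
      has_left_border u v && ~~ has_right_border u v)).
    rewrite RE exchange_wsum; apply: eq_wsum => u un; apply: eq_wsum => v vn.
    by rewrite /right_bordered !has_left_border_swap // un vn.
  transitivity (wsum n (fun _ : seq 'I_k => wsum n (fun _ : seq 'I_k => 1%N))); last first.
    by rewrite !wsum_const muln1 -expnD cE mul2n addnn.
  (* One of the two copies now counts the pairs with only a left-border, so the four classes
     partition all pairs. *)
  rewrite mul2n -addnn {2}RS RE ME UE -!wsumD; apply: eq_wsum => u un.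
  rewrite -!wsumD; apply: eq_wsum => v vn.
  rewrite /mutually_bordered /mutually_unbordered /right_bordered.
  by case: has_right_border; case: has_left_border.
Qed.
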